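(* Let $F:[0,1]\to\mathbb{R}$ be a continuous function. There exists a unique bounded solution of the Dirichlet problem $(DP)$ with boundary data $F$. Moreover, it coincides with the value of the Tug-of-War game with final payoff function $F$.
   Context: Let $m>2$ be an integer and let $\alpha,\beta>0$ with $\alpha+\beta=1$. The directed tree $\mathbb{T}_m$ consists of the empty sequence $\emptyset$ (the root) and all finite sequences $(a_1,\dots,a_k)$, $k\ge1$, with $a_i\in\{0,1,\dots,m-1\}$ (vertices). The set $\mathcal{S}(x)$ of successors of $x$ consists of the $m$ vertices obtained by appending one coordinate to $x$. A branch is an infinite sequence $\pi=(x_1,x_2,\dots)$ of vertices $x_k=(a_1,\dots,a_k)$, and $\partial\mathbb{T}_m$ is the set of branches. Put $\psi(\pi)=\sum_{k\ge1}a_km^{-k}\in[0,1]$; for $F:[0,1]\to\mathbb{R}$, $F(\pi)$ means $F(\psi(\pi))$. A function $u:\mathbb{T}_m\to\mathbb{R}$ is $p$-harmonious if for all $x\in\mathbb{T}_m$, $$u(x)=\frac{\alpha}{2}\Big\{\max_{y\in\mathcal{S}(x)}u(y)+\min_{y\in\mathcal{S}(x)}u(y)\Big\}+\frac{\beta}{m}\sum_{y\in\mathcal{S}(x)}u(y).$$ A solution of $(DP)$ with boundary data $F$ is a $p$-harmonious function $u$ with $\lim_{k\to\infty}u(x_k)=F(\pi)$ for every $\pi=(x_1,\dots,x_k,\dots)\in\partial\mathbb{T}_m$. The game: a token starts at a vertex $x_0$. At each step, with the token at $x_k$, with probability $\alpha/2$ Player I chooses $x_{k+1}\in\mathcal{S}(x_k)$,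 with probability $\alpha/2$ Player II chooses $x_{k+1}\in\mathcal{S}(x_k)$, and with probability $\beta$ the next vertex $x_{k+1}$ is uniformly random in $\mathcal{S}(x_k)$. The game is played forever, generating a branch $\pi$ through $x_0$, and Player I receives $F(\pi)$ from Player II. A strategy $S_I$ (resp. $S_{II}$) of Player I (resp. II) is a collection of measurable maps assigning to each partial history $(x_0,\dots,x_k)$ a vertex of $\mathcal{S}(x_k)$. Strategies $S_I,S_{II}$ and $x_0$ determine a probability measure on the branches through $x_0$ (transported to $[0,1]$ by $\psi$); $\mathbb{E}^{x_0}_{S_I,S_{II}}[F]$ is the expected payoff. Put $u_I(x_0)=\sup_{S_I}\inf_{S_{II}}\mathbb{E}^{x_0}_{S_I,S_{II}}[F]$ and $u_{II}(x_0)=\inf_{S_{II}}\sup_{S_I}\mathbb{E}^{x_0}_{S_I,S_{II}}[F]$. The game has a value, i.e. $u_I=u_{II}$, and this common function on $\mathbb{T}_m$ is called the value of the game. *)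

(* Defs.v *)
From HB Require Import structures.
From mathcomp Require Import all_boot all_order all_algebra.
From mathcomp Require Import all_classical all_reals all_analysis.
Import Order.TTheory GRing.Theory Num.Theory.
Import numFieldNormedType.Exports.

Set Implicit Arguments.
Unset Strict Implicit.
Unset Printing Implicit Defensive.

Local Open Scope classical_set_scope.
Local Open Scope ring_scope.

(* For m > 0 this is 'I_m; the shape n.+1 only provides the element ord0, used
   below to point the type of branches and to start iterated maxima/minima. *)
Definition digit (m : nat) := 'I_m.-1.+1.

(* The vertices of T_m; the successors of x are the [rcons x a], a : digit m. *)
Definition vertex (m : nat) := seq (digit m).

(* The branch (x_1, x_2, ...), x_k = (a_1, ..., a_k), is encoded by its
   coordinates: [pi k] is a_(k+1). *)
Definition branch (m : nat) := nat -> digit m.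

HB.instance Definition _ m := Choice.on (branch m).
HB.instance Definition _ m := isPointed.Build (branch m) (fun=> ord0).

Definition branch_vertex m (pi : branch m) (k : nat) : vertex m := mkseq pi k.

Definition psi (R : realType) m (pi : branch m) : R :=
  limn (series (fun k => (pi k)%:R / m%:R ^+ k.+1 : R)).

Definition p_harmonious (R : realType) m (alpha beta : R) (u : vertex m -> R) :=
  forall x : vertex m,
    u x = alpha / 2 * (\big[Num.max/u (rcons x ord0)]_(a : digit m) u (rcons x a)
                     + \big[Num.min/u (rcons x ord0)]_(a : digit m) u (rcons x a))
        + beta / m%:R * \sum_(a : digit m) u (rcons x a).

Definition DP_solution (R : realType) m (alpha beta : R) (F : R -> R)
    (u : vertex m -> R) :=
  p_harmonious alpha beta u /\
  forall pi : branch m, u (branch_vertex pi k) @[k --> \oo] --> F (psi R pi).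

(* A strategy maps each partial history (x_0, ..., x_k) to the last coordinate
   of the chosen successor of x_k.  There are countably many histories, so
   measurability of these maps is no restriction. *)
Definition strategy m := seq (vertex m) -> digit m.

(* The history of the game started at x0 when the token is at x0 ++ s. *)
Definition history m (x0 s : vertex m) : seq (vertex m) :=
  [seq x0 ++ take k s | k <- iota 0 (size s).+1].

(* The probability that, after history h, the token moves to the successor of
   its position with last coordinate a. *)
Definition step_prob (R : realType) m (alpha beta : R) (SI SII : strategy m)
    (h : seq (vertex m)) (a : digit m) : R :=
  alpha / 2 * (SI h == a)%:R + alpha / 2 * (SII h == a)%:R + beta / m%:R.

Definition cylinder m (x : vertex m) : set (branch m) :=
  [set pi | branch_vertex pi (size x) = x].

Notation branchType m := (g_sigma_algebraType (range (@cylinder m))).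

(* P is the law of the branch generated by the game started at x0. *)
Definition is_game_law (R : realType) m (alpha beta : R) (SI SII : strategy m)
    (x0 : vertex m) (P : probability (branchType m) R) :=
  P (cylinder x0) = 1%E /\
  forall (s : vertex m) (a : digit m),
    P (cylinder (x0 ++ rcons s a)) =
      (P (cylinder (x0 ++ s)) *
       (step_prob alpha beta SI SII (history x0 s) a)%:E)%E.

Lemma measurable_cylinder m (x : vertex m) :
  measurable (cylinder x : set (branchType m)).
Proof. by apply: sub_sigma_algebra; exists x. Qed.

Lemma branch_vertex_take m (pi : branch m) k n :
  (k <= n)%N -> take k (branch_vertex pi n) = branch_vertex pi k.
Proof.
by move=> kn; rewrite /branch_vertex /mkseq -map_take take_iota (minn_idPl kn).
Qed.

Section sampling.
Context (R : realType) (m : nat) (q : vertex m -> digit m -> R).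
Hypothesis q_ge0 : forall s a, 0 <= q s a.
Hypothesis q_sum1 : forall s, \sum_(a : digit m) q s a = 1.

Let c s k := \sum_(b : digit m | (b < k)%N) q s b.
Let w (s : vertex m) := \prod_(k < size s) q (take k s) (nth ord0 s k).
Let l (s : vertex m) :=
  \sum_(k < size s) w (take k s) * c (take k s) (nth ord0 s k).

Let c0 s : c s 0 = 0.
Proof. by rewrite /c big_pred0. Qed.

Let cT s : c s m.-1.+1 = 1.
Proof. by rewrite -(q_sum1 s) /c; apply: eq_bigl => b; rewrite ltn_ord. Qed.

Let cS s (a : digit m) : c s a.+1 = c s a + q s a.
Proof.
rewrite /c (bigD1 a)//= addrC; congr (_ + _); apply: eq_bigl => b.
by rewrite ltnS [in RHS]ltn_neqAle andbC.
Qed.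

Let c_le s i j : (i <= j)%N -> c s i <= c s j.
Proof.
move=> ij; rewrite /c big_mkcond [leRHS]big_mkcond; apply: ler_sum => b _.
case: ltnP => // bi; first by rewrite (leq_trans bi ij).
by case: ifP.
Qed.

Let w_rcons s a : w (rcons s a) = w s * q s a.
Proof.
rewrite /w size_rcons big_ord_recr/= -cats1 take_size_cat// nth_cat ltnn subnn.
congr (_ * _); apply: eq_bigr => i _.
by rewrite takel_cat 1?ltnW// nth_cat ltn_ord.
Qed.

Let l_rcons s a : l (rcons s a) = l s + w s * c s a.
Proof.
rewrite /l size_rcons big_ord_recr/= -cats1 take_size_cat// nth_cat ltnn subnn.
congr (_ + _); apply: eq_bigr => i _.
by rewrite takel_cat 1?ltnW// nth_cat ltn_ord.
Qed.

Let w_ge0 s : 0 <= w s.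
Proof. by apply: prodr_ge0. Qed.

Let I (s : vertex m) (t : R) := l s <= t < l s + w s.

Let I_rcons s a t :
  I (rcons s a) t = (l s + w s * c s a <= t < l s + w s * c s a.+1).
Proof. by rewrite /I l_rcons w_rcons cS mulrDr addrA. Qed.

Let I_sub s a t : I (rcons s a) t -> I s t.
Proof.
rewrite I_rcons => /andP[h1 h2]; apply/andP; split.
  by apply: le_trans h1; rewrite lerDl mulr_ge0 // -(c0 s) c_le.
apply: (lt_le_trans h2); rewrite lerD2l ler_piMr // -(cT s) c_le //.
Qed.

Let I_ex s t : I s t -> exists a, I (rcons s a) t.
Proof.
move=> /andP[h1 h2].
have ex : exists k, t < l s + w s * c s k.
  by exists m.-1.+1; rewrite cT mulr1.
case: (ex_minnP ex) => -[|k]; first by rewrite c0 mulr0 addr0 ltNge h1.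
move=> hk kmin; have km : (k < m.-1.+1)%N.
  by apply: kmin; rewrite cT mulr1.
exists (Ordinal km); rewrite I_rcons hk andbT leNgt.
by apply/negP => /kmin; rewrite ltnn.
Qed.

Let I_inj s t (a b : digit m) : I (rcons s a) t -> I (rcons s b) t -> a = b.
Proof.
have H (i j : digit m) : (i < j)%N -> I (rcons s i) t -> ~ I (rcons s j) t.
  move=> ij; rewrite !I_rcons => /andP[_ h2] /andP[h3 _].
  move: (le_lt_trans h3 h2); rewrite ltrD2l ltNge => /negP; apply.
  by rewrite ler_wpM2l // c_le.
move=> ha hb; apply: val_inj; case: (ltngtP a b) => // h.
  by case: (H _ _ h ha).
by case: (H _ _ h hb).
Qed.

Let next t s : digit m := odflt ord0 [pick a | I (rcons s a) t].
Let pre t n : vertex m := iter n (fun s => rcons s (next t s)) [::].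
Let G t : branchType m := if 0 <= t < 1 then (fun n => next t (pre t n))
                    else (fun=> ord0).

Let size_pre t n : size (pre t n) = n.
Proof. by elim: n => //= n IH; rewrite size_rcons IH. Qed.

Let I_next t s a : I (rcons s a) t -> next t s = a.
Proof.
move=> h; rewrite /next; case: pickP => [b hb|/(_ a)]; last by rewrite h.
exact: I_inj hb h.
Qed.

Let pre_unique t s : I s t -> pre t (size s) = s.
Proof.
elim/last_ind: s => // s a IH h.
by rewrite size_rcons /= (IH (I_sub h)) (I_next h).
Qed.

Let w_nil : w [::] = 1. Proof. by rewrite /w big_ord0. Qed.
Let l_nil : l [::] = 0. Proof. by rewrite /l big_ord0. Qed.

Let I_pre t n : 0 <= t < 1 -> I (pre t n) t.
Proof.
move=> t01; elim: n => [|n IH]; first by rewrite /I /= w_nil l_nil add0r.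
have [a ha] := I_ex IH.
by rewrite /= (I_next ha).
Qed.

Let I_01 t s : I s t -> 0 <= t < 1.
Proof.
elim/last_ind: s => [|s a IH]; first by rewrite /I w_nil l_nil add0r.
by move=> /I_sub.
Qed.

Let vertex_G t n : 0 <= t < 1 -> branch_vertex (G t) n = pre t n.
Proof.
move=> t01; rewrite /G t01; elim: n => // n IH.
by rewrite /branch_vertex in IH *; rewrite mkseqS IH.
Qed.

Let G_cylinder t s : 0 <= t < 1 -> cylinder s (G t) <-> I s t.
Proof.
move=> t01; rewrite /cylinder /= vertex_G//; split => [<-|]; first exact: I_pre.
exact: pre_unique.
Qed.

Let mG : measurable_fun [set: R] G.
Proof.
apply: (@measurability _ _ R (branchType m) setT G (range (@cylinder m))) => //.
move=> _ [_ [s _ <-] <-]; rewrite setTI.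
have -> : G @^-1` cylinder s = `[l s, l s + w s[%classic `|`
   (~` `[0, 1[%classic `&` [set t | cylinder s ((fun=> ord0) : branch m)]).
  apply/seteqP; split => t /=; rewrite !in_itv /=.
    case: (boolP (0 <= t < 1)) => t01; first by move/(G_cylinder _ t01); left.
    by move=> h; right; split=> //; move: h; rewrite /G (negbTE t01).
  move=> [h|[/negP t01 h]]; first exact/(G_cylinder _ (I_01 h)).
  by rewrite /G (negbTE t01).
apply: measurableU => //; apply: measurableI; first exact: measurableC.
have [h|h] := pselect (cylinder s ((fun=> ord0) : branch m)).
  by rewrite (_ : [set t | _] = setT)// -subTset.
by rewrite (_ : [set t | _] = set0)// -subset0.
Qed.

Let m01 : measurable (`[0%R, 1%R[%classic : set R). Proof. by []. Qed.

Let law := pushforward (mrestr (@lebesgue_measure R) m01) G.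

Let lawE s : law (cylinder s) = (w s)%:E.
Proof.
rewrite /law /pushforward /mrestr.
have -> : G @^-1` cylinder s `&` `[0%R, 1%R[%classic = `[l s, l s + w s[%classic.
  apply/seteqP; split => t /=; rewrite !in_itv /=.
    by move=> [h t01]; exact/(G_cylinder _ t01).
  by move=> h; split; [exact/(G_cylinder _ (I_01 h))|exact: I_01 h].
rewrite lebesgue_measure_itv/= lte_fin ltrDl; case: ltP => h.
  by rewrite -EFinB addrAC subrr add0r.
by congr (_%:E); apply/eqP; rewrite eq_le h w_ge0.
Qed.

Lemma branch_law_ex : exists P : probability (branchType m) R,
  P (cylinder [::]) = 1%E /\
  forall s a, P (cylinder (rcons s a)) = (P (cylinder s) * (q s a)%:E)%E.
Proof.
have cyl_nil : cylinder [::] = [set: branch m] by apply/seteqP; split.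
pose mu : {measure set (branchType m) -> \bar R} :=
  measure_function_pushforward__canonical__measure_function_Measure
   (mrestr (@lebesgue_measure R) m01) mG.
have mu1 : mu setT = 1%E by rewrite -cyl_nil -[LHS]/(law _) lawE w_nil.
pose P : probability (branchType m) R :=
  mnormalize mu (dirac (point : branchType m)).
have PE U : P U = law U.
  by rewrite /P /= /mnormalize mu1 onee_eq0 /= invr1 mule1.
by exists P; split=> [|s a]; rewrite !PE ?cyl_nil//;
  rewrite !lawE w_rcons EFinM.
Qed.

End sampling.

Lemma cylinder_take m (x : vertex m) k : cylinder x `<=` cylinder (take k x).
Proof.
move=> pi; rewrite /cylinder /= => {2}<-; rewrite size_take_min.
case: (leqP k (size x)) => [kx|/ltnW xk]; first by rewrite branch_vertex_take.
by rewrite take_oversize // size_mkseq.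
Qed.

Lemma cylinder_disjoint m (x y : vertex m) : (size x <= size y)%N ->
  take (size x) y <> x -> cylinder x `&` cylinder y = set0.
Proof.
move=> xy yx; rewrite -subset0 => pi [] px py; apply: yx.
by rewrite -[in take _ y]py branch_vertex_take.
Qed.

Section game_law.
Context (R : realType) (m : nat) (alpha beta : R) (SI SII : strategy m).
Context (x0 : vertex m).

Lemma step_prob_ge0 h a : 0 <= alpha -> 0 <= beta ->
  0 <= step_prob alpha beta SI SII h a.
Proof.
by move=> a0 b0; rewrite /step_prob !addr_ge0 // ?mulr_ge0 // ?invr_ge0.
Qed.

Let sum_delta (b : digit m) : \sum_(a : digit m) ((b == a)%:R : R) = 1.
Proof.
rewrite (bigD1 b)//= eqxx big1 ?addr0 // => i /negbTE.
by rewrite eq_sym => ->.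
Qed.

Lemma step_prob_sum1 h : (0 < m)%N -> alpha + beta = 1 ->
  \sum_(a : digit m) step_prob alpha beta SI SII h a = 1.
Proof.
move=> m0 ab1; rewrite /step_prob !big_split /= -!mulr_sumr.
rewrite !sum_delta !mulr1 -splitr sumr_const card_ord prednK //.
by rewrite -[m%:R^-1 *+ m]mulr_natr mulVf ?mulr1 // pnatr_eq0 -lt0n.
Qed.

Lemma game_law_ex : (0 < m)%N -> 0 <= alpha -> 0 <= beta -> alpha + beta = 1 ->
  exists P : probability (branchType m) R, is_game_law alpha beta SI SII x0 P.
Proof.
move=> m0 a0 b0 ab1.
pose q (s : vertex m) (a : digit m) : R :=
  if (size s < size x0)%N then (nth ord0 x0 (size s) == a)%:R
  else step_prob alpha beta SI SII (history x0 (drop (size x0) s)) a.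
have q_ge0 s a : 0 <= q s a.
  by rewrite /q; case: ifP => // _; exact: step_prob_ge0.
have q_sum1 s : \sum_(a : digit m) q s a = 1.
  by rewrite /q; case: (size s < size x0)%N; [exact: sum_delta|exact: step_prob_sum1].
have [P [P1 PS]] := branch_law_ex q_ge0 q_sum1.
exists P; split=> [|s a]; last first.
  rewrite -rcons_cat PS /q size_cat ltnNge leq_addr /=.
  by rewrite drop_size_cat.
have Ptake k : (k <= size x0)%N -> P (cylinder (take k x0)) = 1%E.
  elim: k => [|k IH] kx0; first by rewrite take0.
  rewrite (take_nth (ord0 : digit m)) // PS IH ?(ltnW kx0) // /q size_takel ?(ltnW kx0) //.
  by rewrite kx0 eqxx mule1.
by rewrite -[x0]take_size Ptake.
Qed.

Lemma is_game_law_unique (P Q : probability (branchType m) R) :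
  is_game_law alpha beta SI SII x0 P -> is_game_law alpha beta SI SII x0 Q ->
  forall A : set (branchType m), measurable A -> P A = Q A.
Proof.
move=> [P1 PS] [Q1 QS].
have null (P' : probability (branchType m) R) (A : set (branchType m)) :
    P' (cylinder x0) = 1%E -> measurable A -> A `&` cylinder x0 = set0 ->
    P' A = 0%E.
  move=> P'1 mA A0; apply/eqP; rewrite -measure_le0.
  have mx0 := @measurable_cylinder m x0.
  have PU : P' (A `|` cylinder x0) = (P' A + 1)%E.
    by rewrite -P'1; exact: measureU.
  rewrite -(@leeD2rE _ 1%E) // add0e -PU.
  by apply: probability_le1; exact: measurableU.
have full (P' : probability (branchType m) R) (A : set (branchType m)) :
    P' (cylinder x0) = 1%E -> measurable A -> cylinder x0 `<=` A ->
    P' A = 1%E.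
  move=> P'1 mA A0; apply/eqP; rewrite eq_le probability_le1 //=.
  by rewrite -P'1 le_measure ?inE //; exact: measurable_cylinder.
have PQ x : P (cylinder x) = Q (cylinder x).
  have mx := @measurable_cylinder m x.
  have [xx0|/ltnW x0x] := leqP (size x) (size x0).
    have [e|ne] := pselect (take (size x) x0 = x).
      have sub : cylinder x0 `<=` cylinder x.
        by rewrite -[in cylinder x]e; exact: cylinder_take.
      by apply: (etrans (full P _ P1 mx sub)); apply/esym/full.
    have dis := cylinder_disjoint xx0 ne.
    by apply: (etrans (null P _ P1 mx dis)); apply/esym/null.
  have [e|ne] := pselect (take (size x0) x = x0).
    rewrite -(cat_take_drop (size x0) x) e.
    elim/last_ind: (drop _ _) => [|s a IH]; first by rewrite cats0 P1 Q1.
    by rewrite PS QS IH.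
  have dis : cylinder x `&` cylinder x0 = set0.
    by rewrite setIC cylinder_disjoint.
  by apply: (etrans (null P _ P1 mx dis)); apply/esym/null.
pose C : set (set (branchType m)) := set0 |` range (@cylinder m).
have CI : setI_closed C.
  have CI' (x y : vertex m) :
      (size x <= size y)%N -> C (cylinder x `&` cylinder y).
    move=> xy; have [e|ne] := pselect (take (size x) y = x).
      have sub : cylinder y `<=` cylinder x.
        by rewrite -[in cylinder x]e; exact: cylinder_take.
      by rewrite setIC setIidl //; right; exists y.
    by left; rewrite cylinder_disjoint.
  move=> _ _ [->|[x _ <-]] [->|[y _ <-]]; rewrite ?set0I ?setI0; [by left..|].
  by have [/CI'|/ltnW/CI'] := leqP (size x) (size y); rewrite 1?setIC.
move=> A mA; apply: (g_sigma_algebra_measure_unique C _ (fun=> setT)) => //.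
- by move=> _ [->|[x _ <-]] //; exact: measurable_cylinder.
- by move=> _; right; exists [::] => //; apply/seteqP; split.
- by rewrite bigcup_const //; exists 0%N.
- by move=> _ [->|[x _ <-]]; [rewrite !measure0|exact: PQ].
- by move=> _; apply: (le_lt_trans (probability_le1 P measurableT)); rewrite ltry.
- have GC : range (@cylinder m) `<=` C by move=> B; right.
  exact: (sub_sigma_algebra2 GC).
Qed.

End game_law.

(* The Dirac measure is a default value, never used for the parameters of the
   game: see [game_lawP] and [is_game_law_unique]. *)
Definition game_law (R : realType) m (alpha beta : R) (SI SII : strategy m)
    (x0 : vertex m) : probability (branchType m) R :=
  match pselect (exists P, @is_game_law R m alpha beta SI SII x0 P) with
  | left ex => sval (cid ex)
  | right _ => dirac (point : branchType m)
  end.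

Lemma game_lawP (R : realType) m (alpha beta : R) (SI SII : strategy m)
    (x0 : vertex m) :
  (0 < m)%N -> 0 <= alpha -> 0 <= beta -> alpha + beta = 1 ->
  is_game_law alpha beta SI SII x0 (game_law alpha beta SI SII x0).
Proof.
move=> m0 a0 b0 ab1; rewrite /game_law; case: pselect => [ex|[]].
  exact: svalP (cid ex).
exact: game_law_ex.
Qed.

Definition expected_payoff (R : realType) m (alpha beta : R) (F : R -> R)
    (SI SII : strategy m) (x0 : vertex m) : \bar R :=
  expectation (game_law alpha beta SI SII x0) (fun pi => F (psi R pi)).

Definition value_I (R : realType) m (alpha beta : R) (F : R -> R)
    (x0 : vertex m) : \bar R :=
  ereal_sup [set ereal_inf [set expected_payoff alpha beta F SI SII x0
                           | SII in [set: strategy m]]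
            | SI in [set: strategy m]].

Definition value_II (R : realType) m (alpha beta : R) (F : R -> R)
    (x0 : vertex m) : \bar R :=
  ereal_inf [set ereal_sup [set expected_payoff alpha beta F SI SII x0
                           | SI in [set: strategy m]]
            | SII in [set: strategy m]].

(* Main.v *)
(* The right-hand side of the p-harmonious equation is an averaging operator T
   which is monotone, commutes with adding constants, hence is nonexpansive for
   the sup norm.  Extend F to the vertices by g(x) = F(psi(x000...)).  By uniform
   continuity the oscillation of g below a vertex tends to 0 as its depth grows, so
   T^k g is uniformly Cauchy, and its limit u is a fixed point of T which is
   close to g at large depth.  Uniqueness is a comparison principle: the
   difference of two p-harmonious functions does not decrease along a suitable
   branch.  When Player I moves greedily for u, the process u(x_k) is a
   submartingale against any opponent, so the expected payoff is at least u(x0);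
   symmetrically for Player II. *)
Require Import Defs.
From mathcomp Require Import all_boot all_order all_algebra.
From mathcomp Require Import all_classical all_reals all_analysis.
From mathcomp Require Import measurable_realfun lra.
Import Order.TTheory GRing.Theory Num.Theory.
Import numFieldNormedType.Exports.

Set Implicit Arguments.
Unset Strict Implicit.
Unset Printing Implicit Defensive.

Local Open Scope classical_set_scope.
Local Open Scope ring_scope.

(** * Vertices as prefixes of branches *)

Section branches.
Context (m : nat).
Implicit Types (x s : vertex m) (pi : branch m) (P : vertex m -> Prop).

Lemma size_branch_vertex pi k : size (branch_vertex pi k) = k.
Proof. exact: size_mkseq. Qed.

Lemma branch_vertexS pi k :
  branch_vertex pi k.+1 = rcons (branch_vertex pi k) (pi k).
Proof. exact: mkseqS. Qed.

Lemma branch_vertex_le pi pi' k n : (k <= n)%N ->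
  branch_vertex pi n = branch_vertex pi' n ->
  branch_vertex pi k = branch_vertex pi' k.
Proof.
by move=> kn e; rewrite -(branch_vertex_take pi kn) e branch_vertex_take.
Qed.

Lemma branch_vertex_inj pi pi' n i : (i < n)%N ->
  branch_vertex pi n = branch_vertex pi' n -> pi i = pi' i.
Proof.
by move=> lt_in /(congr1 (nth ord0 ^~ i)); rewrite !nth_mkseq.
Qed.

(** Past the end of [x] the default digit is read, so [nth ord0 x] is the branch x000... *)
Lemma branch_vertex_nth x : branch_vertex (nth ord0 x) (size x) = x.
Proof. exact: mkseq_nth. Qed.

Lemma branch_vertex_nthK pi k :
  branch_vertex (nth ord0 (branch_vertex pi k)) k = branch_vertex pi k.
Proof. by rewrite -[RHS]branch_vertex_nth size_branch_vertex. Qed.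

(** A choice of successor, made total by [ord0] where [P] fails, is iterated from the root. *)
Lemma exists_branch P : P [::] -> (forall x, P x -> exists a, P (rcons x a)) ->
  exists pi, forall k, P (branch_vertex pi k).
Proof.
move=> P0 PS.
have /choice[next nextP] : forall x, exists a, P x -> P (rcons x a).
  move=> x; have [/PS[a Pa]|nPx] := pselect (P x); first by exists a.
  by exists ord0.
pose pre k := iter k (fun y => rcons y (next y)) [::].
pose pi : branch m := fun k => next (pre k).
have preE k : branch_vertex pi k = pre k.
  by elim: k => // k IH; rewrite branch_vertexS IH.
exists pi => k; rewrite preE; elim: k => // k IH; exact: nextP.
Qed.

Lemma exists_branch_from P x : P x ->
  (forall y, P y -> exists a, P (rcons y a)) ->
  exists pi, forall k, (size x <= k)%N -> P (branch_vertex pi k).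
Proof.
move=> Px PS; pose Q y := take (size y) x = y /\ (size y < size x)%N \/ P y.
have Qtake k : (k <= size x)%N -> Q (take k x).
  rewrite leq_eqVlt => /predU1P[->|kx]; first by rewrite take_size; right.
  by left; rewrite size_takel ?(ltnW kx).
have [||pi piQ] := @exists_branch Q.
- by rewrite -(take0 x); exact: Qtake.
- move=> y [[e yx]|/PS[a Pa]]; last by exists a; right.
  by exists (nth ord0 x (size y)); rewrite -{1}e -take_nth //; exact: Qtake.
exists pi => k xk; case: (piQ k) => // -[_].
by rewrite size_branch_vertex ltnNge xk.
Qed.

End branches.

(** * Digit expansions in base m *)

Section psi_estimates.
Context (R : realType) (m : nat).
Hypothesis m_gt1 : (1 < m)%N.
Implicit Types pi : branch m.

Let dig pi : nat -> R := fun k => (pi k)%:R / m%:R ^+ k.+1.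

Let m_gt0 : (0 : R) < m%:R.
Proof. by rewrite ltr0n ltnW. Qed.

Lemma dig_ge0 pi k : 0 <= dig pi k.
Proof. by rewrite /dig divr_ge0 // exprn_ge0. Qed.

(** A digit is at most m - 1, so each term is below a telescoping difference, and the tail after k
    terms is at most m^-k. *)
Lemma dig_le pi k : dig pi k <= m%:R^-1 ^+ k - m%:R^-1 ^+ k.+1.
Proof.
have -> : m%:R^-1 ^+ k - m%:R^-1 ^+ k.+1 = m.-1%:R / m%:R ^+ k.+1 :> R.
  rewrite -subn1 natrB 1?ltnW // mulrBl mul1r -!exprVn; congr (_ - _).
  by rewrite exprS mulrA divff ?mul1r // gt_eqF.
by rewrite ler_pM2r ?invr_gt0 ?exprn_gt0 // ler_nat -ltnS.
Qed.

Lemma series_dig_le pi k j :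
  series (dig pi) (k + j)%N <=
  series (dig pi) k + m%:R^-1 ^+ k - m%:R^-1 ^+ (k + j)%N.
Proof.
elim: j => [|j IH]; first by rewrite addn0 addrK.
rewrite addnS seriesSr; have := dig_le pi (k + j)%N; lra.
Qed.

Lemma series_dig_nd pi : nondecreasing_seq (series (dig pi)).
Proof.
by apply/nondecreasing_seqP => n; rewrite seriesSr lerDl dig_ge0.
Qed.

Lemma series_dig_bnd pi k n :
  series (dig pi) n <= series (dig pi) k + m%:R^-1 ^+ k.
Proof.
have pk j : 0 <= m%:R^-1 ^+ j :> R by rewrite exprn_ge0 // invr_ge0.
have [nk|/ltnW kn] := leqP n k.
  by have := series_dig_nd pi nk; have := pk k; lra.
by have := series_dig_le pi k (n - k); rewrite subnKC //; have := pk n; lra.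
Qed.

Lemma psi_bounds pi k :
  series (dig pi) k <= psi R pi <= series (dig pi) k + m%:R^-1 ^+ k.
Proof.
have cv : cvgn (series (dig pi)).
  apply: nondecreasing_is_cvgn; first exact: series_dig_nd.
  exists (series (dig pi) 0 + m%:R^-1 ^+ 0) => _ [n _ <-].
  exact: series_dig_bnd.
apply/andP; split.
  exact: nondecreasing_cvgn_le (series_dig_nd pi) cv k.
by apply: limr_le => //; apply: nearW => n; exact: series_dig_bnd.
Qed.

Lemma psi01 pi : psi R pi \in `[0, 1].
Proof.
by have := psi_bounds pi 0; rewrite /series /= big_nil expr0 add0r in_itv.
Qed.

(** The common prefix confines both values to one interval of length m^-k. *)
Lemma psi_dist pi pi' k : branch_vertex pi k = branch_vertex pi' k ->
  `|psi R pi - psi R pi'| <= m%:R^-1 ^+ k.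
Proof.
move=> e; have : series (dig pi) k = series (dig pi') k.
  rewrite /series /= !big_mkord; apply: eq_bigr => i _.
  by rewrite /dig (branch_vertex_inj (ltn_ord i) e).
have := psi_bounds pi k; have := psi_bounds pi' k.
by rewrite ler_norml; lra.
Qed.

End psi_estimates.

(** * Uniform continuity on the space of branches *)

Definition unif_continuous_branch (R : realType) m (f : branch m -> R) :=
  forall e : R, 0 < e -> exists N, forall pi pi' : branch m,
    branch_vertex pi N = branch_vertex pi' N -> `|f pi - f pi'| <= e.

(* Koenig's lemma replaces the Heine theorem: were the oscillation of [F \o psi]
   on deep cylinders to stay above e, it would do so along a branch, against
   the continuity of F at the image of that branch. *)
Lemma unif_continuous_psi (R : realType) m (F : R -> R) : (1 < m)%N ->
  {within `[0, 1], continuous F} ->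
  unif_continuous_branch (fun pi : branch m => F (psi R pi)).
Proof.
move=> m1 cF e e0; apply: contrapT => /forallNP nU.
(* Agreement is asked up to every level N, not only up to [x]; this lets badness pass to some
   child. *)
pose bad (x : vertex m) := forall N, exists pi pi' : branch m,
  [/\ branch_vertex pi (size x) = x, branch_vertex pi N = branch_vertex pi' N
    & e < `|F (psi R pi) - F (psi R pi')|].
have [||pi0 bad0] := @exists_branch m bad.
- move=> N; have /existsNP[pi /existsNP[pi']] := nU N.
  move=> /not_implyP[E /negP]; rewrite -ltNge => lt; exists pi, pi'.
  by split=> //; rewrite /branch_vertex /=.
- move=> x badx; apply: contrapT => /forallNP nbad.
  have /choice[N NP] : forall a, exists N, ~ exists pi pi' : branch m,
    [/\ branch_vertex pi (size x).+1 = rcons x a,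
        branch_vertex pi N = branch_vertex pi' N
      & e < `|F (psi R pi) - F (psi R pi')|].
    by move=> a; have /existsNP[N] := nbad a; rewrite size_rcons; exists N.
  (* A pair agreeing up to the largest of the children's levels contradicts the level chosen for the
     child through which [pi] passes. *)
  have [pi [pi' [pix pipi' lt]]] := badx (\max_a N a).
  apply: (NP (pi (size x))); exists pi, pi'; split=> //.
    by rewrite branch_vertexS pix.
  by apply: branch_vertex_le pipi'; exact: leq_bigmax.
have /subspace_continuousP/(_ _ (psi01 R m1 pi0)) := cF.
move=> /cvgrPdist_le/(_ (e / 2) (divr_gt0 e0 (ltr0Sn R 1))).
rewrite near_withinE => /nbhs_ballP[d /= d0 Fd].
have : (m%:R^-1 : R) ^+ k @[k --> \oo] --> 0.
  apply: cvg_expr; rewrite ger0_norm ?invr_ge0 // invf_lt1 ?ltr1n //.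
  by rewrite ltr0n ltnW.
move=> /cvgrPdist_lt/(_ d d0)[M _ /(_ M (leqnn M))].
rewrite /= sub0r normrN ger0_norm ?exprn_ge0 ?invr_ge0 // => Md.
(* Both branches share M digits with [pi0], so both values are within e / 2 of the value at [pi0],
   against a gap above e. *)
have [pi [pi' []]] := bad0 M M; rewrite size_branch_vertex => E E'.
have close pi1 : branch_vertex pi1 M = branch_vertex pi0 M ->
    `|F (psi R pi0) - F (psi R pi1)| <= e / 2.
  move=> E1; apply: Fd; last exact: psi01.
  by rewrite /ball /=; apply: le_lt_trans Md; exact: psi_dist.
have := close _ E; have := close pi'; rewrite -E' => /(_ E).
by rewrite !ler_norml ltNge ler_norml; lra.
Qed.

(** * The averaging operator and the comparison principle *)

Section dynamic_programming.
Context (R : realType) (m : nat) (alpha beta : R).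
Hypotheses (m_gt0 : (0 < m)%N) (alpha_ge0 : 0 <= alpha) (beta_ge0 : 0 <= beta).
Hypothesis alphaDbeta : alpha + beta = 1.
Implicit Types (u v : vertex m -> R) (x : vertex m) (c : R).

Definition average u x : R :=
  alpha / 2 * (\big[Num.max/u (rcons x ord0)]_(a : digit m) u (rcons x a)
             + \big[Num.min/u (rcons x ord0)]_(a : digit m) u (rcons x a))
  + beta / m%:R * \sum_(a : digit m) u (rcons x a).

Lemma sum_const_digit c : \sum_(a : digit m) c = m%:R * c.
Proof. by rewrite sumr_const card_ord prednK // mulr_natl. Qed.

(** Maximum, minimum and mean over the children are monotone and shift with constants; the weights
    alpha/2, alpha/2 and beta add up to 1. *)
Lemma average_le u v x c : (forall a, u (rcons x a) <= v (rcons x a) + c) ->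
  average u x <= average v x + c.
Proof.
move=> uv; rewrite /average.
set Mu := \big[Num.max/_]__ _; set mu := \big[Num.min/_]__ _.
set Mv := \big[Num.max/_]__ _; set mv := \big[Num.min/_]__ _.
have HM : Mu <= Mv + c.
  by apply: bigmax_le => [|a _]; apply: le_trans (uv _) _;
    rewrite lerD2r le_bigmax.
have Hm : mu <= mv + c.
  rewrite -lerBlDr; apply: le_bigmin => [|a _];
    by rewrite lerBlDr; apply: le_trans (uv _); rewrite bigmin_le.
have a2 : 0 <= alpha / 2 by rewrite divr_ge0.
have bm : 0 <= beta / m%:R by rewrite divr_ge0.
have HS : \sum_(a : digit m) u (rcons x a) <=
    \sum_(a : digit m) v (rcons x a) + m%:R * c.
  by rewrite -sum_const_digit -big_split ler_sum.
have := ler_wpM2l a2 (lerD HM Hm); have := ler_wpM2l bm HS.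
rewrite !mulrDr (mulrA (beta / _)) divfK ?pnatr_eq0 ?gtn_eqF // => h1 h2.
have : c = alpha * c + beta * c by rewrite -mulrDl alphaDbeta mul1r.
by lra.
Qed.

Lemma average_dist u v x c :
  (forall a, `|u (rcons x a) - v (rcons x a)| <= c) ->
  `|average u x - average v x| <= c.
Proof.
move=> uv; have := @average_le u v x c; have := @average_le v u x c.
rewrite ler_norml => h1 h2.
have /h1 : forall a, v (rcons x a) <= u (rcons x a) + c.
  by move=> a; have := uv a; rewrite ler_norml; lra.
have /h2 : forall a, u (rcons x a) <= v (rcons x a) + c.
  by move=> a; have := uv a; rewrite ler_norml; lra.
lra.
Qed.

Lemma average_cst c x : average (fun=> c) x = c.
Proof.
rewrite /average sum_const_digit mulrA divfK ?pnatr_eq0 ?gtn_eqF //.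
have -> : \big[Num.max/c]_(a : digit m) c = c.
  by apply/eqP; rewrite eq_le bigmax_ge_id andbT; apply: bigmax_le.
have -> : \big[Num.min/c]_(a : digit m) c = c.
  by apply/eqP; rewrite eq_le bigmin_le_id /=; apply: le_bigmin.
have : alpha * c + beta * c = c by rewrite -mulrDl alphaDbeta mul1r.
lra.
Qed.

Lemma iter_average_cst k c x : iter k average (fun=> c) x = c.
Proof.
suff -> : iter k average (fun=> c) = (fun=> c) by [].
by elim: k => //= k ->; apply/funext => y; rewrite average_cst.
Qed.

(** The k-th iterate at [x] depends only on the values exactly k levels below [x]. *)
Lemma iter_average_dist k u v x c :
  (forall s, size s = k -> `|u (x ++ s) - v (x ++ s)| <= c) ->
  `|iter k average u x - iter k average v x| <= c.
Proof.
elim: k x => [|k IH] x uv /=; first by have := uv [::] erefl; rewrite cats0.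
apply: average_dist => a; apply: IH => s sk.
by rewrite cat_rcons; apply: uv; rewrite /= sk.
Qed.

(** At a child maximizing [u - v], the difference bounds that at all siblings, hence that at [x] by
    [average_le]. *)
Lemma p_harmonious_le_child u v x :
  p_harmonious alpha beta u -> p_harmonious alpha beta v ->
  exists a, u x - v x <= u (rcons x a) - v (rcons x a).
Proof.
move=> hu hv; pose d (a : digit m) := u (rcons x a) - v (rcons x a).
have [a amax] : exists a, forall b, d b <= d a.
  by exists [arg max_(a > ord0) d a]%O; case: arg_maxP => // a _ h b; exact: h.
exists a; rewrite lerBlDl addrC (hu x) (hv x) addrC; apply: average_le => b.
by have := amax b; rewrite /d; lra.
Qed.

(* The difference of two solutions does not decrease along some branch, and
   tends to 0 along every branch. *)
Lemma DP_solution_le (F : R -> R) u v :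
  DP_solution alpha beta F u -> DP_solution alpha beta F v ->
  forall x, u x <= v x.
Proof.
move=> [hu limu] [hv limv] x; rewrite leNgt; apply/negP => vu.
pose d := u x - v x.
have [||pi piP] := @exists_branch_from m (fun y => d <= u y - v y) x.
- exact: lexx.
- move=> y dy; have [a ha] := p_harmonious_le_child y hu hv.
  by exists a; exact: le_trans ha.
have : u (branch_vertex pi k) - v (branch_vertex pi k) @[k --> \oo] --> (0 : R).
  by rewrite -(subrr (F (psi R pi))); exact: cvgB.
have d0 : 0 < d by rewrite subr_gt0.
move=> /cvgrPdist_lt/(_ d d0)[M _ /(_ (maxn M (size x)) (leq_maxl _ _))] /=.
rewrite sub0r normrN; have := piP _ (leq_maxr M (size x)).
by move=> h; rewrite ltNge (le_trans h) // ler_norm.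
Qed.

(** * Existence by iterating the averaging operator *)

Section boundary_data.
Variable f : branch m -> R.
Hypothesis f_unif : unif_continuous_branch f.

Let g x : R := f (nth ord0 x).

Definition value_fun x : R := lim (iter k average g x @[k --> \oo]).

(** Level N has finitely many vertices, and [f] varies by at most 1 below each; the sum of the
    [|g t|] is a crude bound at that level. *)
Lemma unif_branch_bounded : exists M, forall pi, `|f pi| <= M.
Proof.
have [N NP] := f_unif ltr01.
pose M := \sum_(t : N.-tuple (digit m)) `|g t|.
exists (1 + M) => pi.
have h : `|g (branch_vertex pi N)| <= M.
  have sN : size (branch_vertex pi N) == N by rewrite size_branch_vertex.
  by rewrite /M (bigD1 (Tuple sN)) //= lerDl sumr_ge0.
have h1 := NP _ _ (esym (branch_vertex_nthK pi N)).
have := ler_normD (f pi - g (branch_vertex pi N)) (g (branch_vertex pi N)).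
by rewrite subrK; move: h h1; rewrite /g; lra.
Qed.

Lemma boundary_extension_dist e : 0 < e -> exists N, forall x s,
  (N <= size x)%N -> `|g (x ++ s) - g x| <= e.
Proof.
move=> e0; have [N NP] := f_unif e0; exists N => x s Nx; apply: NP.
apply: (branch_vertex_le Nx); rewrite branch_vertex_nth.
rewrite -(branch_vertex_take _ (leq_addr (size s) (size x))) -size_cat.
by rewrite branch_vertex_nth take_size_cat.
Qed.

(** The condition bears on [size x + k], the depth at which [g] is read, so deep vertices require
    few iterations. *)
Lemma iter_average_cauchy e : 0 < e -> exists N, forall x k j,
  (N <= size x + k)%N ->
  `|iter (k + j)%N average g x - iter k average g x| <= e.
Proof.
move=> e0; have [N NP] := boundary_extension_dist e0; exists N => x k j Nk.
rewrite iterD; apply: iter_average_dist => s sk.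
(* The j extra iterations start at depth at least N, where [g] is nearly the constant [g (x ++ s)],
   and constants are fixed points. *)
rewrite -[g (x ++ s)](iter_average_cst j _ (x ++ s)).
apply: iter_average_dist => t _; apply: NP.
by rewrite size_cat sk.
Qed.

Lemma value_fun_cvg x : iter k average g x @[k --> \oo] --> value_fun x.
Proof.
apply/cauchy_cvgP/cauchy_exP => e e0.
have [N NP] := iter_average_cauchy (divr_gt0 e0 (ltr0Sn R 1)).
exists (iter N average g x); exists N => // k Nk.
rewrite /= /ball /= distrC -(subnKC Nk).
by apply: le_lt_trans (NP _ _ _ (leq_addl _ _)) _; lra.
Qed.

Lemma value_fun_dist e : 0 < e -> exists N, forall x k,
  (N <= size x + k)%N -> `|value_fun x - iter k average g x| <= e.
Proof.
move=> e0; have [N NP] := iter_average_cauchy e0; exists N => x k Nk.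
have cv : (`|iter n average g x - iter k average g x|) @[n --> \oo]
    --> `|value_fun x - iter k average g x|.
  by apply: cvg_norm; apply: cvgB; [exact: value_fun_cvg|exact: cvg_cst].
rewrite -(cvg_lim _ cv) //; apply: limr_le; first by apply: cvgP cv.
exists k => // n /= kn; rewrite -(subnKC kn); exact: NP.
Qed.

Lemma value_fun_harmonious : p_harmonious alpha beta value_fun.
Proof.
move=> x; apply/eqP; rewrite -subr_eq0 -normr_le0; apply/ler_addgt0Pl => e e0.
have [N NP] := value_fun_dist (divr_gt0 e0 (ltr0Sn R 1)).
(* One application of [average] links the N-th iterate at the children to the next iterate at
   [x]. *)
have h1 := NP x N.+1 (leq_trans (leqnSn N) (leq_addl _ _)).
have h2 : `|average value_fun x - average (iter N average g) x| <= e / 2.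
  by apply: average_dist => a; apply: NP; rewrite leq_addl.
rewrite -/(average value_fun x) addr0.
by move: h1 h2; rewrite /= !ler_norml; lra.
Qed.

Lemma value_fun_boundary e : 0 < e -> exists N, forall pi k,
  (N <= k)%N -> `|f pi - value_fun (branch_vertex pi k)| <= e.
Proof.
move=> e0; have e20 := divr_gt0 e0 (ltr0Sn R 1).
have [N NP] := value_fun_dist e20; have [M MP] := f_unif e20.
exists (maxn N M) => pi k; rewrite geq_max => /andP[Nk Mk].
(* Zero iterations: deep in the tree [g] itself is already close to the limit. *)
have := NP (branch_vertex pi k) 0; rewrite addn0 size_branch_vertex /=.
move=> /(_ Nk) h1.
have := MP _ _ (branch_vertex_le Mk (esym (branch_vertex_nthK pi k))).
by move: h1; rewrite /g !ler_norml; lra.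
Qed.

Lemma value_fun_bounded : bounded_fun value_fun.
Proof.
have [M MP] := unif_branch_bounded.
have MM x : `|value_fun x| <= M.
  have cv : (`|iter n average g x|) @[n --> \oo] --> `|value_fun x|.
    by apply: cvg_norm; exact: value_fun_cvg.
  rewrite -(cvg_lim _ cv) //; apply: limr_le; first by apply: cvgP cv.
  (* The iterates are compared with those of the constant 0. *)
  apply: nearW => n; rewrite -[iter _ _ _ _]subr0 -(iter_average_cst n 0 x).
  by apply: iter_average_dist => s _; rewrite subr0; exact: MP.
exists M; split; first exact: num_real.
by move=> K MK x _ /=; apply: le_trans (MM x) (ltW MK).
Qed.

End boundary_data.

End dynamic_programming.

(** * Measurability and integration on the space of branches *)

Section branch_integrals.
Context (R : realType) (m : nat).
Implicit Types (x : vertex m) (f : branch m -> R).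

(** There are countably many vertices, so the preimage is a countable union of cylinders; the
    condition on [x] enters as a full or empty set. *)
Lemma measurable_fun_branch_vertex (h : vertex m -> R) k :
  measurable_fun [set: branchType m] (fun pi => h (branch_vertex pi k)).
Proof.
move=> _ B mB; rewrite setTI.
have -> : (fun pi : branch m => h (branch_vertex pi k)) @^-1` B =
    \bigcup_x (cylinder x `&` [set pi | size x = k /\ B (h x)]).
  apply/seteqP; split => [pi Bpi|pi [x _ [/= <- [<-]]]]; last first.
    by rewrite /= size_branch_vertex.
  exists (branch_vertex pi k) => //; split => /=; last first.
    by rewrite size_branch_vertex.
  by rewrite /cylinder /= size_branch_vertex.
apply: countable_bigcupT_measurable => [|x]; first exact: countableP.
have [h1|h1] := pselect (size x = k /\ B (h x)).
  rewrite (_ : [set _ | _] = setT) ?setIT; first exact: measurable_cylinder.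
  by apply/seteqP; split.
by rewrite (_ : [set _ | _] = set0) ?setI0 //; apply/seteqP; split.
Qed.

(** [f] is the pointwise limit of its values on truncated branches padded with zeros, which depend
    on finitely many digits. *)
Lemma unif_continuous_branch_measurable f : unif_continuous_branch f ->
  measurable_fun [set: branchType m] f.
Proof.
move=> uf; pose h k (pi : branchType m) := f (nth ord0 (branch_vertex pi k)).
apply: (@measurable_fun_cvg _ _ _ _ h) => [k|pi _].
  exact: (measurable_fun_branch_vertex (fun x => f (nth ord0 x))).
apply/cvgrPdist_le => e e0; have [N NP] := uf e e0.
exists N => // k /= Nk; apply: NP; apply: (branch_vertex_le Nk).
by rewrite branch_vertex_nthK.
Qed.

Lemma cylinder_children x :
  cylinder x = \big[setU/set0]_(a <- enum (digit m)) cylinder (rcons x a).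
Proof.
rewrite -bigcup_seq; apply/seteqP; split => [pi pix|pi [a _]].
  exists (pi (size x)); first by rewrite /= mem_enum.
  by rewrite /cylinder /= size_rcons branch_vertexS pix.
by rewrite /cylinder /= size_rcons branch_vertexS => /rcons_inj[].
Qed.

Lemma trivIset_cylinder_children x (A : set (digit m)) :
  trivIset A (fun a => cylinder (rcons x a)).
Proof.
move=> a b _ _ [pi []]; rewrite /cylinder /= !size_rcons => ->.
by move=> /rcons_inj[].
Qed.

Lemma unif_continuous_branch_integrable f (P : probability (branchType m) R)
    (A : set (branchType m)) : unif_continuous_branch f -> measurable A ->
  P.-integrable A (EFin \o f).
Proof.
move=> uf mA; have [M MP] := unif_branch_bounded uf.
apply: measurable_bounded_integrable => //.
- by rewrite (le_lt_trans (probability_le1 P mA)) // ltry.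
- apply: measurable_funS (unif_continuous_branch_measurable uf) => //.
- exists M; split; first exact: num_real.
  by move=> K MK pi _ /=; exact: le_trans (MP pi) (ltW MK).
Qed.

End branch_integrals.

(** * Submartingale bound for the expected payoff *)

Section game_bounds.
Context (R : realType) (m : nat) (alpha beta : R) (SI SII : strategy m).
Hypotheses (m_gt0 : (0 < m)%N) (alphaDbeta : alpha + beta = 1).
Hypotheses (alpha_ge0 : 0 <= alpha) (beta_ge0 : 0 <= beta).
Context (x0 : vertex m) (P : probability (branchType m) R).
Hypothesis P_law : is_game_law alpha beta SI SII x0 P.
Implicit Types w : vertex m -> R.

Let sp s a := step_prob alpha beta SI SII (history x0 s) a.

Lemma step_prob_mean h (w : digit m -> R) :
  \sum_(a : digit m) step_prob alpha beta SI SII h a * w a =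
  alpha / 2 * (w (SI h) + w (SII h)) + beta / m%:R * \sum_(a : digit m) w a.
Proof.
have delta (b : digit m) : \sum_(a : digit m) (b == a)%:R * w a = w b.
  rewrite (bigD1 b) //= eqxx mul1r big1 ?addr0 // => a /negbTE.
  by rewrite eq_sym => ->; rewrite mul0r.
rewrite -(delta (SI h)) -(delta (SII h)) -big_split /= !mulr_sumr -big_split /=.
by apply: eq_bigr => a _; rewrite /step_prob; lra.
Qed.

(* Downward induction on the depth: at large depth [f] is close to [w] on each
   cylinder, and the submartingale inequality carries the bound to x0. *)
Lemma submartingale_expectation (f : branch m -> R) w :
  unif_continuous_branch f ->
  (forall s, w (x0 ++ s) <=
     \sum_(a : digit m) sp s a * w (x0 ++ rcons s a)) ->
  (forall e, 0 < e -> exists N, forall pi k, (N <= k)%N ->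
     w (branch_vertex pi k) - e <= f pi) ->
  ((w x0)%:E <= expectation P f)%E.
Proof.
move=> uf subm lim; have [P1 PS] := P_law.
have int (A : set (branchType m)) : measurable A -> P.-integrable A (EFin \o f).
  exact: unif_continuous_branch_integrable.
have mcyl := @measurable_cylinder m.
(* The law is carried by the branches through [x0]. *)
have -> : expectation P f = (\int[P]_(pi in cylinder x0) (f pi)%:E)%E.
  rewrite unlock (@negligible_integral _ _ _ _ _
    (~` cylinder x0 : set (branchType m))) //.
  - by rewrite setTD setCK.
  - exact: measurableC.
  - exact: int.
  - by apply: etrans (probability_setC P (mcyl x0)) _; rewrite P1 subee.
apply/lee_addgt0Pr => e e0; have [N NP] := lim e e0.
rewrite -leeBlDr // -EFinB.
(* Here j counts the levels left before depth N. Weighting by the mass of the cylinder avoids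
   conditioning on null events. *)
suff H j s : (N <= size (x0 ++ s) + j)%N ->
    ((w (x0 ++ s) - e)%:E * P (cylinder (x0 ++ s)) <=
     \int[P]_(pi in cylinder (x0 ++ s)) (f pi)%:E)%E.
  by have := H N [::] (leq_addl _ _); rewrite cats0 P1 mule1.
elim: j s => [|j IH] s.
  rewrite addn0 => Ns; rewrite -integral_cst //; apply: le_integral => //.
  - exact: finite_measure_integrable_cst.
  - exact: int.
  - by move=> pi; rewrite inE /cylinder /= => pis; rewrite lee_fin -pis NP.
rewrite addnS -addSn => Ns.
rewrite {2}cylinder_children integral_bigsetU_EFin //; first last.
- apply/measurable_EFinP.
  by apply: measurable_funS (unif_continuous_branch_measurable uf).
- exact: trivIset_cylinder_children.
- exact: enum_uniq.
have [p Pp] : exists p, P (cylinder (x0 ++ s)) = p%:E.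
  by exists (fine (P (cylinder (x0 ++ s)))); rewrite fineK // fin_num_measure.
have p0 : 0 <= p by rewrite -lee_fin -Pp.
rewrite big_enum /=.
apply: (@le_trans _ _ (\sum_(a : digit m)
   ((w (x0 ++ rcons s a) - e) * (p * sp s a))%:E)%E); last first.
  apply: lee_sum => a _; rewrite rcons_cat.
  apply: le_trans (IH _ _); last by rewrite -rcons_cat size_rcons.
  by rewrite PS Pp -!EFinM.
rewrite sumEFin Pp -EFinM lee_fin.
have -> : \sum_(a : digit m) (w (x0 ++ rcons s a) - e) * (p * sp s a) =
    p * (\sum_(a : digit m) sp s a * w (x0 ++ rcons s a)
         - e * \sum_(a : digit m) sp s a).
  rewrite [e * _]mulr_sumr -sumrB mulr_sumr; apply: eq_bigr => a _; lra.
rewrite /sp step_prob_sum1 // mulr1 mulrC ler_wpM2l // lerD2r; exact: subm.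
Qed.

Lemma last_history (s : vertex m) : last [::] (history x0 s) = x0 ++ s.
Proof.
by rewrite /history -addn1 iotaD map_cat /= add0n cats1 last_rcons take_size.
Qed.

End game_bounds.

(** * Greedy strategies of the two players *)

Section greedy.
Context (R : realType) (m : nat) (alpha beta : R) (u : vertex m -> R).
Hypotheses (m_gt0 : (0 < m)%N) (alphaDbeta : alpha + beta = 1).
Hypotheses (alpha_ge0 : 0 <= alpha) (beta_ge0 : 0 <= beta).
Context (f : branch m -> R).
Hypotheses (uf : unif_continuous_branch f) (hu : p_harmonious alpha beta u).
Hypothesis u_lim : forall e, 0 < e -> exists N, forall pi k, (N <= k)%N ->
  `|f pi - u (branch_vertex pi k)| <= e.

(** Only the last vertex of the history, the position of the token, matters; [[::]] is a default, as
    game histories are nonempty. *)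
Definition greedy_max : strategy m := fun h =>
  [arg max_(a > ord0) u (rcons (last [::] h) a)]%O.

Definition greedy_min : strategy m := fun h =>
  [arg min_(a < ord0) u (rcons (last [::] h) a)]%O.

(** Player I attains the maximum and Player II gets at least the minimum, so the p-harmonious
    equation yields the submartingale inequality. *)
Lemma greedy_max_expectation SII x :
  ((u x)%:E <= expectation (game_law alpha beta greedy_max SII x) f)%E.
Proof.
apply: (submartingale_expectation m_gt0 alphaDbeta
  (game_lawP _ _ x m_gt0 alpha_ge0 beta_ge0 alphaDbeta))
  => // [s|e /u_lim[N NP]].
- under eq_bigr do rewrite -rcons_cat.
  rewrite (step_prob_mean _ _ _ _ _ (fun a => u (rcons (x ++ s) a))).
  rewrite [leLHS]hu lerD2r ler_wpM2l ?divr_ge0 //; apply: lerD.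
    rewrite /greedy_max last_history; case: arg_maxP => // a _ amax.
    by apply: bigmax_le => [|b _]; exact: amax.
  exact: bigmin_le.
- by exists N => pi k Nk; have := NP pi k Nk; rewrite ler_norml; lra.
Qed.

(** The submartingale bound is applied to [- u] and [- f]. *)
Lemma greedy_min_expectation SI x :
  (expectation (game_law alpha beta SI greedy_min x) f <= (u x)%:E)%E.
Proof.
set P := game_law _ _ _ _ _.
have law : is_game_law alpha beta SI greedy_min x P by exact: game_lawP.
have ufN : unif_continuous_branch (fun pi => - f pi).
  move=> e /uf[N NP]; exists N => pi pi' /NP.
  by rewrite -opprD normrN.
have : ((- u x)%R%:E <= expectation P (fun pi => (- f pi)%R))%E.
  apply: (submartingale_expectation m_gt0 alphaDbeta law ufN
           (w := fun y => - u y)) => [s|e /u_lim[N NP]].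
  - under eq_bigr do rewrite -rcons_cat mulrN.
    rewrite sumrN lerN2.
    rewrite (step_prob_mean _ _ _ _ _ (fun a => u (rcons (x ++ s) a))).
    rewrite [leRHS]hu lerD2r ler_wpM2l ?divr_ge0 //; apply: lerD.
      exact: le_bigmax.
    rewrite /greedy_min last_history; case: arg_minP => // a _ amin.
    by apply: le_bigmin => [|b _]; exact: amin.
  - by exists N => pi k Nk; have := NP pi k Nk; rewrite ler_norml; lra.
have -> : expectation P (fun pi => - f pi)%R = (- expectation P f)%E.
  have intf : P.-integrable setT (EFin \o f).
    exact: unif_continuous_branch_integrable.
  rewrite !unlock -integralN //; exact: integrable_add_def.
by rewrite EFinN leeN2.
Qed.

End greedy.

(** * Well-posedness of the Dirichlet problem and the value of the game *)

Theorem theorem3p4 (R : realType) (m : nat) (alpha beta : R) (F : R -> R) :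
  (2 < m)%N -> 0 < alpha -> 0 < beta -> alpha + beta = 1 ->
  {within `[0, 1], continuous F} ->
  exists u : vertex m -> R,
    [/\ DP_solution alpha beta F u /\ bounded_fun u,
        forall v : vertex m -> R,
          DP_solution alpha beta F v -> bounded_fun v -> v = u
      & forall x : vertex m,
          value_I alpha beta F x = (u x)%:E /\
          value_II alpha beta F x = (u x)%:E].
Proof.
move=> m2 a0 b0 ab1 cF.
have m1 : (1 < m)%N by exact: ltnW.
have m0 : (0 < m)%N by exact: ltnW.
have [a0' b0'] := (ltW a0, ltW b0).
pose f (pi : branch m) := F (psi R pi).
have uf : unif_continuous_branch f by exact: unif_continuous_psi.
pose u := value_fun alpha beta f.
have hu : p_harmonious alpha beta u by exact: value_fun_harmonious.
have ubd := value_fun_boundary m0 a0' b0' ab1 uf.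
have DPu : DP_solution alpha beta F u.
  split=> // pi; apply/cvgrPdist_le => e /ubd[N NP].
  by exists N => // k /= Nk; exact: NP.
exists u; split.
- by split=> //; exact: value_fun_bounded.
- move=> v DPv _; apply/funext => x; apply/le_anti/andP.
  by split; apply: (DP_solution_le m0 a0' b0' ab1 (F := F)).
have maxE SII x :
    ((u x)%:E <= expected_payoff alpha beta F (greedy_max u) SII x)%E.
  exact: (greedy_max_expectation m0 ab1 a0' b0' uf hu ubd).
have minE SI x :
    (expected_payoff alpha beta F SI (greedy_min u) x <= (u x)%:E)%E.
  exact: (greedy_min_expectation m0 ab1 a0' b0' uf hu ubd).
(* The greedy strategies form a saddle point: each guarantees [u x] against every opponent, which
   gives all four inequalities. *)
move=> x; split; apply/eqP; rewrite eq_le; apply/andP; split.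
- apply: ge_ereal_sup => _ [SI _ <-].
  apply: le_trans (minE SI x); apply: ereal_inf_lbound.
  by exists (greedy_min u).
- apply: (le_trans _ (ereal_sup_ubound _)); last by exists (greedy_max u).
  by apply: le_ereal_inf_tmp => _ [SII _ <-]; exact: maxE.
- apply: (le_trans (ereal_inf_lbound _)); first by exists (greedy_min u).
  by apply: ge_ereal_sup => _ [SI _ <-]; exact: minE.
- apply: le_ereal_inf_tmp => _ [SII _ <-].
  apply: le_trans (maxE SII x) _; apply: ereal_sup_ubound.
  by exists (greedy_max u).
Qed.
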